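(* Let $\Bbbk$ be a field of characteristic $2$, let $E$ be a $\Bbbk$-vector space of dimension $2m+1$, and let $X\subset|E|\cong\mathbb{P}^{2m}$ be the base scheme of a regular pencil of quadrics in $|E|$. Assume $m\ge 2$. If $\Bbbk$ is a perfect field, then the variety $X$ contains a canonical $(m-2)$-plane $\Pi$ defined over $\Bbbk$. In particular, a del Pezzo surface of degree $4$ over a perfect field of characteristic $2$ has a canonical point.
   Context: $|E|$ denotes the projective space of lines in $E$. A pencil of quadrics in $|E|$ is given by a two-dimensional linear space of quadratic forms on $E$, spanned by $q_0,q_1\in S^2E^\vee$; its base scheme is $X=V(q_0,q_1)=V(q_0)\cap V(q_1)\subset|E|$. The pencil is regular if $X$ is smooth over $\Bbbk$ and of codimension $2$ in $|E|$. An $(m-2)$-plane is a projective linear subspace of dimension $m-2$. A del Pezzo surface of degree $4$ is, in its anticanonical embedding, a smooth complete intersection of two quadrics in $\mathbb{P}^4$ (the case $m=2$). *)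

(* Defs.v *)
From HB Require Import structures.
From mathcomp Require Import all_boot all_algebra.

Set Implicit Arguments.
Unset Strict Implicit.
Unset Printing Implicit Defensive.

Import GRing.Theory.
Local Open Scope ring_scope.

Definition perfect_field (k : fieldType) : Prop :=
  forall p : nat, p \in [pchar k] -> forall a : k, exists b : k, b ^+ p = a.

Definition polar (k : fieldType) (E : vectType k) (q : E -> k) (x y : E) : k :=
  q (x + y) - q x - q y.

(* An element of S^2 E^\vee.  Its coefficients in a basis (e_i) are the q e_i and
   the polar q e_i e_j for i < j, so these functions correspond bijectively to
   homogeneous polynomials of degree 2 on E, in every characteristic and over
   every field, including finite ones.  In particular, a form that vanishes at
   all the vectors of a subspace U is zero as a polynomial on U. *)
Record qform (k : fieldType) (E : vectType k) : Type := QForm {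
  qform_fun :> E -> k;
  qformZ : forall (a : k) (x : E), qform_fun (a *: x) = a ^+ 2 * qform_fun x;
  qform_polar : forall x : E, scalar (polar qform_fun x)
}.

(* A two-dimensional space of quadratic forms, given by a basis (q_0, q_1). *)
Record pencil (k : fieldType) (E : vectType k) : Type := Pencil {
  pencil_gen :> 'I_2 -> qform E;
  pencil_free : forall c : 'I_2 -> k,
    (forall x, \sum_i c i * pencil_gen i x = 0) -> forall i, c i = 0
}.

(* The line spanned by x <> 0 is a k-point of the base scheme V(q_0, q_1). *)
Definition in_base (k : fieldType) (E : vectType k) (W : pencil E) (x : E) : Prop :=
  forall i, W i x = 0.

(* phi identifies V with the scalar extension of E along f : k -> K.  If f is
   bijective, phi is a semilinear isomorphism; if f is the identity, phi is a
   linear isomorphism. *)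
Definition extension_of_scalars (k K : fieldType) (f : {rmorphism k -> K})
    (E : vectType k) (V : vectType K) (phi : {linear E -> V | f \; *:%R}) : Prop :=
  basis_of {:V} [seq phi e | e <- vbasis {:E}].

(* Moreover, phi carries the pencil W, extended to K, onto the pencil W': the
   matrix A expresses the basis of W' in the basis of W.  A quadratic form on V
   is determined by its composite with phi. *)
Definition pencil_extension (k K : fieldType) (f : {rmorphism k -> K})
    (E : vectType k) (V : vectType K) (phi : {linear E -> V | f \; *:%R})
    (W : pencil E) (W' : pencil V) : Prop :=
  extension_of_scalars phi /\
  exists2 A : 'M[K]_2, A \in unitmx &
    forall i x, W' i (phi x) = \sum_j A i j * f (W j x).

(* The differentials of q_0, q_1 at x, which are the linear forms polar q_i x,
   are linearly independent. *)
Definition jacobian_independent (k : fieldType) (E : vectType k) (W : pencil E)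
    (x : E) : Prop :=
  forall c : 'I_2 -> k,
    (forall v, \sum_i c i * polar (W i) x v = 0) -> forall i, c i = 0.

(* V(q_0, q_1) is smooth over k of codimension 2 in |E|: smoothness of relative
   dimension dim |E| - 2 is the linear independence of the differentials of the
   two equations, required at the points with values in all the extensions of k. *)
Definition regular (k : fieldType) (E : vectType k) (W : pencil E) : Prop :=
  forall (K : fieldType) (f : {rmorphism k -> K}) (V : vectType K)
         (phi : {linear E -> V | f \; *:%R}) (W' : pencil V),
    pencil_extension phi W W' ->
    forall x : V, x != 0 -> in_base W' x -> jacobian_independent W' x.

(* The projectivization of U is a d-plane in |E|. *)
Definition is_plane (k : fieldType) (E : vectType k) (d : nat) (U : {vspace E}) : Prop :=
  \dim U = d.+1.

Definition perfect_char2 (k : fieldType) : Prop :=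
  2%N \in [pchar k] /\ perfect_field k.

Definition odd_regular (m : nat) (k : fieldType) (E : vectType k) (W : pencil E) : Prop :=
  [/\ (2 <= m)%N, \dim {:E} = (2 * m + 1)%N & regular W].

Definition subspace_choice : Type :=
  forall (k : fieldType) (E : vectType k), pencil E -> {vspace E}.

(* Functoriality.  Taking f and phi to be identities, the subspace depends only
   on the pencil and not on its basis; taking f or phi bijective, it is carried
   along by (semi)linear isomorphisms and thus stable under automorphisms; in
   general, its formation commutes with extension of the perfect base field. *)
Definition canonical (Pi : subspace_choice) : Prop :=
  forall (m : nat) (k K : fieldType) (f : {rmorphism k -> K})
         (E : vectType k) (V : vectType K) (phi : {linear E -> V | f \; *:%R})
         (W : pencil E) (W' : pencil V),
    perfect_char2 k -> perfect_char2 K -> odd_regular m W -> odd_regular m W' ->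
    pencil_extension phi W W' ->
    Pi K V W' = <<[seq phi u | u <- vbasis (Pi k E W)]>>%VS.

(* A del Pezzo surface of degree 4 in its anticanonical embedding. *)
Definition quartic_del_pezzo (k : fieldType) (E : vectType k) (W : pencil E) : Prop :=
  \dim {:E} = 5%N /\ regular W.

(* Main.v *)
Require Import Defs.
From HB Require Import structures.
From mathcomp Require Import all_boot all_algebra all_field.
From mathcomp Require Import zify ring.
From Stdlib Require Import Classical ClassicalEpsilon.

Set Implicit Arguments.
Unset Strict Implicit.
Unset Printing Implicit Defensive.

Import GRing.Theory.
Local Open Scope ring_scope.

(** The idea.  Let n = 2m+1 = dim E, let b_0, b_1 be the polar forms of
q_0, q_1, and for c = (c_0, c_1) let b_c = c_0 b_0 + c_1 b_1 be the polar form
of q_c = c_0 q_0 + c_1 q_1.  In characteristic 2 the b_c are alternating.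

The space E contains a subspace L of dimension m+1 on which b_0 and b_1 both
vanish.  Over any field, any two alternating forms on a space of dimension
2m+1 have such a subspace ([common_isotropic]): it is built one vector at a
time, because an alternating form has even rank, so that it degenerates on
every odd-dimensional space.

If the pencil is regular, L is unique ([isotropic_unique]).  The key is that
then no member b_c, even over an extension of k, has a radical of dimension
greater than 1 ([polar_radical_le1]).  The dimension of the radical is odd, so
otherwise it would be at least 3; q_c is additive on the radical, hence, after
adjunction of square roots, the square of a linear form, and it vanishes on a
subspace of dimension 2 of the radical; over a further extension another
member of the pencil vanishes at some nonzero point of this subspace, which is
then a singular point of the base scheme.  Now if U and V are two distinct
candidates for L, the forms b_0, b_1 induce a pencil of square matrices on
U/(U n V) x V/(U n V), which has a degenerate member over an extension; by a
dimension count the radical of the same b_c would have dimension at least 2.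

On L the forms q_0 and q_1 are additive.  Over a perfect field each of them is
therefore the square of a linear form, q_i = l_i^2, and the common zeros of
q_0 and q_1 in L form a linear subspace Pi, the kernel of (l_0, l_1).  The
forms l_0, l_1 are independent, so that dim Pi = m-1 ([base_plane_rank]):
otherwise Pi contains a subspace P of dimension m; the pencil of m x m
matrices induced on P x E/L has a degenerate member over an extension, which
gives a vector of P in the radical of some b_c, where the base scheme is
singular.

Uniqueness of L also gives functoriality: an extension of scalars carries L to
an isotropic subspace of dimension m+1, hence to the L of the new pencil, and
Pi into the new Pi, which has the same dimension.

The computations are made on matrices in the coordinates of a basis: a
quadratic form is x |-> x Q x^T, and its polar form has matrix Q + Q^T. *)

(** * Extensions of the base field *)

Lemma lift0E : lift 0 0 = 1 :> 'I_2.
Proof. exact: val_inj. Qed.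

Lemma irreducible_divisor (k : fieldType) (p : {poly k}) :
  (1 < size p)%N -> exists2 q, irreducible_poly q & q %| p.
Proof.
have [n] := ubnP (size p); elim: n p => // n IHn p lepn p1.
have [irr_p|red_p] := classic (irreducible_poly p); first by exists p.
suff [q [q1 ltqp dvd_qp]] : exists q : {poly k}, [/\ (1 < size q)%N, (size q < size p)%N & q %| p].
  have [r irr_r dvd_rq] := IHn q (leq_trans ltqp lepn) q1.
  by exists r => //; apply: dvdp_trans dvd_qp.
apply: NNPP => noq; apply: red_p; split=> // q q1 dvd_qp.
have p0 : p != 0 by rewrite -size_poly_gt0 ltnW.
have q0 : q != 0 by apply: contraTneq dvd_qp => ->; rewrite dvd0p.
rewrite -(dvdp_size_eqp dvd_qp) eqn_leq dvdp_leq //= leqNgt; apply/negP => ltqp.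
apply: noq; exists q; split => //.
by rewrite ltn_neqAle eq_sym q1 size_poly_gt0.
Qed.

Lemma adjoin_root (k : fieldType) (p : {poly k}) : (1 < size p)%N ->
  exists (K : fieldType) (f : {rmorphism k -> K}) (a : K), root (map_poly f p) a.
Proof.
case/irreducible_divisor=> q irr_q dvd_qp.
have [K _ [z rz _]] := irredp_FAdjoin irr_q.
exists K, (in_alg K : {rmorphism k -> K}), z.
by rewrite -(divpK dvd_qp) rmorphM rootM rz orbT.
Qed.

(** Used to turn the diagonal quadratic forms of characteristic 2 into squares of
linear forms. *)
Lemma adjoin_sqrts (k : fieldType) (s : seq k) :
  exists (K : fieldType) (f : {rmorphism k -> K}),
    forall a, a \in s -> exists b, b ^+ 2 = f a.
Proof.
elim: s => [|a s [K [f sqrt_s]]].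
  by exists k, (idfun : {rmorphism k -> k}).
have [|K' [g [b rb]]] := @adjoin_root K ('X^2 - (f a)%:P).
  by rewrite size_XnsubC.
exists K', (g \o f : {rmorphism k -> K'}) => c /[1!inE] /predU1P[->|/sqrt_s[d fc]].
  exists b; move: rb.
  rewrite rmorphB /= map_polyXn map_polyC /= /root !hornerE subr_eq0.
  by move/eqP.
by exists (g d); rewrite /= -fc rmorphXn.
Qed.

(** If M_1 is singular, it is the degenerate member; otherwise M_0 - a M_1 is one
for an eigenvalue a of M_0 M_1^-1, which exists over some extension. *)
Lemma degenerate_member (k : fieldType) d (M : 'I_2 -> 'M[k]_d) : (0 < d)%N ->
  exists (K : fieldType) (f : {rmorphism k -> K}) (c : 'I_2 -> K) (x : 'rV[K]_d),
    [/\ exists i, c i != 0, x != 0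
      & x *m (\sum_i c i *: map_mx f (M i)) = 0].
Proof.
move=> d0; have [u1|] := boolP (M 1 \in unitmx); last first.
  rewrite -row_free_unit -kermx_eq0 => /rowV0Pn[x /sub_kermxP xM x0].
  exists k, (idfun : {rmorphism k -> k}), (fun i => (i == 1)%:R), x; split=> //.
    by exists 1; rewrite oner_eq0.
  by rewrite !big_ord_recl big_ord0 scale0r add0r addr0 scale1r map_mx_id // lift0E.
have [|K [f [a ra]]] := @adjoin_root k (char_poly (M 0 *m invmx (M 1))).
  by rewrite size_char_poly.
have: eigenvalue (map_mx f (M 0 *m invmx (M 1))) a.
  by rewrite eigenvalue_root_char -map_char_poly.
case/eigenvalueP=> x xa x0.
exists K, f, (fun i => if i == 0 then 1 else - a), x; split=> //.
  by exists 0; rewrite oner_eq0.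
rewrite !big_ord_recl big_ord0 /= addr0 lift0E.
have -> : M 0 = M 0 *m invmx (M 1) *m M 1 by rewrite mulmxKV.
by rewrite scale1r mulmxDr map_mxM mulmxA xa -scalemxAr scaleNr scalemxAl subrr.
Qed.

(** A binary quadratic form a X^2 + b X Y + c Y^2 vanishes at (1, 0) if a = 0,
and otherwise at (t, 1) for a root t of a polynomial of degree 2. *)
Lemma isotropic_vector (k : fieldType) (G : 'M[k]_2) :
  exists (K : fieldType) (f : {rmorphism k -> K}) (y : 'rV[K]_2),
    y != 0 /\ y *m map_mx f G *m y^T = 0.
Proof.
have [G0|G0] := eqVneq (G 0 0) 0.
  exists k, (idfun : {rmorphism k -> k}), (delta_mx 0 0); split.
    by apply/negP => /eqP/matrixP/(_ 0 0)/eqP; rewrite !mxE oner_eq0.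
  rewrite map_mx_id // -rowE; apply/matrixP => i j; rewrite !ord1 !mxE.
  by rewrite !big_ord_recl big_ord0 !mxE G0 /= !(mul0r, mulr0, addr0).
pose p := (G 0 0)%:P * 'X^2 + (G 0 1 + G 1 0)%:P * 'X + (G 1 1)%:P.
have [|K [f [a]]] := @adjoin_root k p.
  suff: p`_2 != 0 by apply: contraR; rewrite -leqNgt => le1; rewrite nth_default // ltnW.
  by rewrite /p !coefE /= !(mulr0, mulr1, addr0).
rewrite /p 2!rmorphD 2!rmorphM /= map_polyXn map_polyX !map_polyC /= /root !hornerE.
move/eqP => pa; exists K, f, (\row_j if j == 0 then a else 1); split.
  by apply/negP => /eqP/matrixP/(_ 0 1)/eqP; rewrite !mxE oner_eq0.
apply/matrixP => i j; rewrite !ord1 !mxE !(big_ord_recl, big_ord0) !mxE.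
rewrite !(big_ord_recl, big_ord0) !mxE /= -[RHS]pa.
have -> : lift 0 0 = 1 :> 'I_2 by apply: val_inj.
have -> : ord0 = 0 :> 'I_2 by apply: val_inj.
rewrite [f (_ + _)]rmorphD /=. ring.
Qed.

(** * Alternating forms *)

Definition alternating (k : fieldType) n (B : 'M[k]_n) : Prop :=
  forall x : 'rV_n, x *m B *m x^T = 0.

Lemma alternating_skew (k : fieldType) n (B : 'M[k]_n) :
  alternating B -> B^T = - B.
Proof.
move=> altB; apply/matrixP => i j; rewrite !mxE.
have ent a b : ((delta_mx 0 a : 'rV_n) *m B *m (delta_mx 0 b : 'rV_n)^T) 0 0 = B a b.
  by rewrite trmx_delta -rowE -colE !mxE.
have /matrixP/(_ 0 0) := altB (delta_mx 0 i + delta_mx 0 j).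
rewrite linearD /= !mulmxDl !mulmxDr !altB add0r addr0.
by rewrite mxE !ent mxE => /eqP; rewrite addr_eq0 => /eqP->; rewrite opprK.
Qed.

Lemma alternating_restr (k : fieldType) h n (P : 'M[k]_(h, n)) (B : 'M[k]_n) :
  alternating B -> alternating (P *m B *m P^T).
Proof. by move=> altB x; rewrite !mulmxA -mulmxA -trmx_mul altB. Qed.

(** Any vector x orthogonal to an isotropic U can be added to U, since x is
orthogonal to itself; the process stops at a U that contains its orthogonal. *)
Lemma maximal_isotropic (k : fieldType) n (B : 'M[k]_n) : alternating B ->
  exists U : 'M[k]_n, U *m B *m U^T = 0 /\ (kermx (B *m U^T) <= U)%MS.
Proof.
move=> altB.
suff extend d (U : 'M[k]_n) : (n - \rank U <= d)%N -> U *m B *m U^T = 0 ->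
    exists U : 'M[k]_n, U *m B *m U^T = 0 /\ (kermx (B *m U^T) <= U)%MS.
  by apply: (extend n 0); rewrite ?mul0mx ?leq_subr.
elim: d U => [|d IHd] U ltd isoU.
  exists U; split=> //; apply: submx_full.
  by rewrite /row_full eqn_leq rank_leq_row /= -subn_eq0 -leqn0.
have [|/row_subPn[i]] := boolP (kermx (B *m U^T) <= U)%MS; first by exists U.
set x := row i _ => xU.
have xBU : x *m B *m U^T = 0.
  by apply/eqP; rewrite -mulmxA -sub_kermx row_sub.
have UBx : U *m B *m x^T = 0.
  apply: (can_inj trmxK); rewrite !trmx_mul trmxK (alternating_skew altB).
  by rewrite mulNmx mulmxN mulmxA xBU oppr0 linear0.
apply: (IHd (U + x)%MS).
  have: (U < U + x)%MS.
    rewrite ltmxE addsmxSl /=; apply: contra xU; apply: submx_trans.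
    exact: addsmxSr.
  by move/rank_ltmx => ltr; rewrite leq_subLR; move: ltd; rewrite leq_subLR; lia.
have : (U + x <= kermx (B *m (U + x)%MS^T))%MS.
  have UxB: (U + x)%MS *m B *m (col_mx U x)^T = 0.
    apply/eqP; rewrite -mulmxA -sub_kermx addsmx_sub !sub_kermx !mulmxA.
    by rewrite tr_col_mx !mul_mx_row isoU UBx xBU altB !row_mx0 !eqxx.
  have /submxP[D eqD] : (U + x <= col_mx U x)%MS by rewrite addsmxE.
  by rewrite sub_kermx mulmxA [X in X^T]eqD trmx_mul mulmxA UxB mul0mx.
by rewrite sub_kermx mulmxA => /eqP.
Qed.

(** A maximal isotropic U equals its orthogonal and contains the radical of B, so
dim U = n - rk (U B) with rk (U B) = dim U - (n - rk B); hence
rk B = 2 (n - dim U). *)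
Lemma rank_alternating_even (k : fieldType) n (B : 'M[k]_n) :
  alternating B -> ~~ odd (\rank B).
Proof.
move=> altB; have [U [isoU maxU]] := maximal_isotropic altB.
have kerU : (kermx B <= U)%MS.
  by apply: submx_trans maxU; rewrite sub_kermx mulmxA mulmx_ker mul0mx.
have eqU : \rank (kermx (B *m U^T)) = \rank U.
  apply/eqP; rewrite eqn_leq !mxrankS // sub_kermx mulmxA isoU //.
have rBU : \rank (B *m U^T) = \rank (U *m B).
  by rewrite -mxrank_tr trmx_mul trmxK (alternating_skew altB) mulmxN mxrank_opp.
have rcap : \rank (U :&: kermx B)%MS = (n - \rank B)%N.
  by rewrite (capmx_idPr kerU) mxrank_ker.
have := mxrank_mul_ker U B; rewrite rcap => rUB.
move: eqU; rewrite mxrank_ker rBU => eqU.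
have := rank_leq_row B; have := rank_leq_row U; have := rank_leq_row (U *m B).
lia.
Qed.

(** * A common isotropic subspace of two alternating forms *)

Lemma orth_sub (k : fieldType) n m1 m2 p1 p2 (B : 'M[k]_n)
    (X : 'M_(m1, n)) (X' : 'M_(m2, n)) (Y : 'M_(p1, n)) (Y' : 'M_(p2, n)) :
  (X <= X')%MS -> (Y <= Y')%MS -> X' *m B *m Y'^T = 0 -> X *m B *m Y^T = 0.
Proof.
move=> /submxP[C ->] /submxP[D ->] orth.
by rewrite trmx_mul !mulmxA -(mulmxA C) -(mulmxA C) orth mulmx0 mul0mx.
Qed.

Lemma orth_sym (k : fieldType) n p q (B : 'M[k]_n) (X : 'M_(p, n)) (Y : 'M_(q, n)) :
  alternating B -> X *m B *m Y^T = 0 -> Y *m B *m X^T = 0.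
Proof.
move=> altB orth; apply: (can_inj trmxK).
by rewrite !trmx_mul trmxK (alternating_skew altB) mulNmx mulmxN mulmxA orth oppr0 linear0.
Qed.

(** The form that B induces on H lives on a space whose radical has the parity
of dim H, while U, contained in this radical, has the other parity. *)
Lemma radical_vector (k : fieldType) n (B : 'M[k]_n) (U H : 'M[k]_n) :
  alternating B -> (U <= H)%MS -> U *m B *m H^T = 0 ->
  odd (\rank U + \rank H) ->
  exists e : 'rV_n, [/\ (e <= H)%MS, ~~ (e <= U)%MS & H *m B *m e^T = 0].
Proof.
move=> altB sUH orthU oddUH; 
have [P freeP PH] : exists2 P : 'M_(\rank H, n), row_free P & (P :=: H)%MS.
  by exists (row_base H); [apply: row_base_free | apply: eq_row_base].
have /submxP[Y defU] : (U <= P)%MS by rewrite PH.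
set G := P *m B *m P^T.
have evenG : ~~ odd (\rank G) by exact/rank_alternating_even/alternating_restr.
have rY : \rank Y = \rank U by rewrite defU mxrankMfree.
have sYG : (Y <= kermx G)%MS.
  rewrite sub_kermx /G !mulmxA. rewrite -defU; apply/eqP/(orth_sub _ _ orthU) => //.
  by rewrite PH.
have /row_subPn[i] : ~~ (kermx G <= Y)%MS.
  apply/negP => sGY; have := mxrankS sGY; have := mxrankS sYG.
  rewrite mxrank_ker rY; have := rank_leq_row G; lia.
set z := row i _ => zY; exists (z *m P); split.
- by rewrite -PH submxMl.
- by rewrite defU submxMfree.
apply: orth_sym => //; apply: (@orth_sub _ _ _ _ _ _ _ _ (z *m P) _ P) => //.
  by rewrite PH.
by apply/eqP; rewrite -!mulmxA [P *m _]mulmxA -sub_kermx row_sub.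
Qed.

(** Adding e to U and replacing H by the part of H orthogonal to e keeps the
pair (U, H) orthogonal.  The dimension of U grows by 1 and that of H drops by
at most 2.  If dim U + dim H is exactly 2m+1, the drop must be at most 1, so e
is taken in the radical of the restriction of B0 to H, outside U; parity
provides it ([radical_vector]). *)
Lemma isotropic_step (k : fieldType) n (B0 B1 : 'M[k]_n) (U H : 'M[k]_n) m :
  alternating B0 -> alternating B1 ->
  (U <= H)%MS -> U *m B0 *m H^T = 0 -> U *m B1 *m H^T = 0 ->
  (\rank U <= m)%N -> (2 * m + 1 <= \rank U + \rank H)%N ->
  exists U' H' : 'M[k]_n,
    [/\ (U' <= H')%MS, U' *m B0 *m H'^T = 0, U' *m B1 *m H'^T = 0,
        \rank U' = (\rank U).+1 & (2 * m + 1 <= \rank U' + \rank H')%N].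
Proof.
move=> alt0 alt1 sUH orth0 orth1 rU rUH.
pose cut (e : 'rV_n) := (H :&: kermx (B0 *m e^T) :&: kermx (B1 *m e^T))%MS.
have rcap (X : 'M_n) (M : 'cV[k]_n) : (\rank X <= (\rank (X :&: kermx M)).+1)%N.
  by have := mxrank_mul_ker X M; have := rank_leq_col (X *m M); lia.
have [e [eH eU re]] : exists e : 'rV_n,
    [/\ (e <= H)%MS, ~~ (e <= U)%MS & (2 * m <= \rank U + \rank (cut e))%N].
  have [ltUH|] := leqP (2 * m + 2) (\rank U + \rank H).
    have /row_subPn[i iU] : ~~ (H <= U)%MS.
      by apply/negP => /mxrankS; lia.
    exists (row i H); rewrite row_sub; split=> //.
    have := rcap H (B0 *m (row i H)^T).
    have := rcap (H :&: kermx (B0 *m (row i H)^T))%MS (B1 *m (row i H)^T).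
    rewrite -/(cut (row i H)); lia.
  move=> ltUH; have [|e [eH eU He]] := radical_vector alt0 sUH orth0; first by lia.
  exists e; split=> //; have := rcap (H :&: kermx (B0 *m e^T))%MS (B1 *m e^T).
  rewrite -/(cut e).
  have -> : \rank (H :&: kermx (B0 *m e^T)) = \rank H.
    by rewrite (capmx_idPl _) // sub_kermx mulmxA He.
  lia.
have cutH : (cut e <= H)%MS by rewrite /cut -capmxA capmxSl.
have cut0 : cut e *m B0 *m e^T = 0.
  apply/eqP; rewrite -mulmxA -sub_kermx /cut.
  exact: submx_trans (capmxSl _ _) (capmxSr _ _).
have cut1 : cut e *m B1 *m e^T = 0.
  by apply/eqP; rewrite -mulmxA -sub_kermx capmxSr.
have rUe : \rank (U + e)%MS = (\rank U).+1.
  apply/eqP; rewrite eqn_leq; apply/andP; split.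
    by have := (mxrank_adds_leqif U e).1; have := rank_leq_row e; lia.
  apply: rank_ltmx; rewrite ltmxE addsmxSl; apply: contra eU; apply: submx_trans.
  exact: addsmxSr.
have addP (B : 'M_n) : alternating B -> U *m B *m H^T = 0 -> cut e *m B *m e^T = 0 ->
    (U + e)%MS *m B *m (cut e)^T = 0.
  move=> altB orthU orthe; apply/eqP; rewrite -mulmxA -sub_kermx addsmx_sub.
  rewrite !sub_kermx !mulmxA (orth_sub (submx_refl U) cutH orthU).
  by rewrite (orth_sym altB orthe) !eqxx.
exists (U + e)%MS, (cut e); split; [|exact: addP..|exact: rUe|by rewrite rUe; lia].
rewrite addsmx_sub !sub_capmx sUH eH !sub_kermx !mulmxA alt0 alt1.
by rewrite (orth_sub (submx_refl U) eH orth0) (orth_sub (submx_refl U) eH orth1) !eqxx.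
Qed.

(** Starting from U = 0 and H the whole space, m+1 steps give a U contained in
its own orthogonal for both forms. *)
Lemma common_isotropic (k : fieldType) m n (B0 B1 : 'M[k]_n) :
  n = (2 * m + 1)%N ->
  alternating B0 -> alternating B1 ->
  exists L : 'M[k]_n,
    [/\ \rank L = m.+1, L *m B0 *m L^T = 0 & L *m B1 *m L^T = 0].
Proof.
move=> nE alt0 alt1; subst n.
suff [U [H [sUH orth0 orth1 rU _]]] : exists U H : 'M[k]_(2 * m + 1),
    [/\ (U <= H)%MS, U *m B0 *m H^T = 0, U *m B1 *m H^T = 0, \rank U = m.+1
      & (2 * m + 1 <= \rank U + \rank H)%N].
  exists U; split=> //.
    exact: orth_sub (submx_refl U) sUH orth0.
  exact: orth_sub (submx_refl U) sUH orth1.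
have : (m.+1 <= m.+1)%N by [].
elim: {1 3}(m.+1) => [|r IHr] ler.
  exists 0, 1%:M; rewrite sub0mx !mul0mx mxrank0 mxrank1; split=> //.
have [U [H [sUH orth0 orth1 rU rUH]]] := IHr (ltnW ler).
have [|U' [H' [? ? ? rU' ?]]] := isotropic_step alt0 alt1 sUH orth0 orth1 _ rUH.
  by rewrite rU.
by exists U', H'; split; rewrite // rU' rU.
Qed.

(** * Additive quadratic forms in characteristic 2 *)

Lemma row_free_sub (k : fieldType) p n d (A : 'M[k]_(p, n)) :
  (d <= \rank A)%N -> exists2 N : 'M_(d, n), row_free N & (N <= A)%MS.
Proof.
move=> led; exists ((pid_mx d : 'M_(d, \rank A)) *m row_base A).
  by rewrite /row_free mxrankMfree ?row_base_free // rank_pid_mx.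
by apply: submx_trans (submxMl _ _) _; rewrite eq_row_base.
Qed.

Lemma addrr_pchar2 (k : fieldType) (V : lmodType k) (v : V) :
  2%N \in [pchar k] -> v + v = 0.
Proof. by move=> char2; rewrite -mulr2n -scaler_nat (pcharf0 char2) scale0r. Qed.

Lemma sqr_sum_pchar2 (k : fieldType) (I : finType) (F : I -> k) :
  2%N \in [pchar k] -> (\sum_i F i) ^+ 2 = \sum_i F i ^+ 2.
Proof.
move=> char2; rewrite -(pFrobenius_autE char2) rmorph_sum.
by apply: eq_bigr => i _; rewrite -(pFrobenius_autE char2).
Qed.

Lemma trmx_mx11 (k : fieldType) (a : 'M[k]_1) : a^T = a.
Proof. by apply/matrixP => i j; rewrite !ord1 mxE. Qed.

(** A quadratic form whose polar form is zero is a diagonal form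
sum_j a_j z_j^2, and in characteristic 2, if a_j = s_j^2, this is the square of
the linear form sum_j s_j z_j. *)
Lemma additive_form_square (k : fieldType) d (G : 'M[k]_d) (s : 'cV_d) (z : 'rV_d) :
  2%N \in [pchar k] -> G + G^T = 0 -> (forall j, s j 0 ^+ 2 = G j j) ->
  z *m G *m z^T = (z *m s) *m (z *m s).
Proof.
move=> char2 skewG sG.
pose F (y : 'rV_d) := (y *m G *m y^T) 0 0.
have FD : {morph F : x y / x + y}.
  move=> x y; have cross : x *m G *m y^T + y *m G *m x^T = 0.
    rewrite -[y *m G *m x^T]trmx_mx11 !trmx_mul trmxK mulmxA.
    by rewrite -mulmxDl -mulmxDr skewG mulmx0 mul0mx.
  rewrite /F linearD /= !mulmxDl !mulmxDr addrA -(addrA (x *m G *m x^T)).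
  by rewrite cross addr0 mxE.
have F0 : F 0 = 0 by rewrite /F !mul0mx mxE.
apply/matrixP => a b; rewrite !ord1 -/(F z) [X in F X]row_sum_delta.
rewrite (big_morph F FD F0) mxE big_ord1 -expr2 mxE sqr_sum_pchar2 //.
apply: eq_bigr => j _; rewrite exprMn sG /F linearZ /= -!scalemxAl -scalemxAr.
by rewrite trmx_delta -rowE -colE !mxE mulrA expr2.
Qed.

(** * Regular pencils in coordinates: radicals of the polar forms *)

Definition polar_mx (k : fieldType) n (Q : 'M[k]_n) : 'M_n := Q + Q^T.

(** Regularity of the pencil of forms x |-> x (Q i) x^T, tested only on the
scalar extensions in coordinates. *)
Definition regular_mx (k : fieldType) n (Q : 'I_2 -> 'M[k]_n) : Prop :=
  forall (K : fieldType) (f : {rmorphism k -> K}) (x : 'rV[K]_n), x != 0 ->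
    (forall i, x *m map_mx f (Q i) *m x^T = 0) ->
    forall c : 'I_2 -> K,
      x *m (\sum_i c i *: map_mx f (polar_mx (Q i))) = 0 -> forall i, c i = 0.

Lemma regular_mx_map (k K : fieldType) (f : {rmorphism k -> K}) n (Q : 'I_2 -> 'M[k]_n) :
  regular_mx Q -> regular_mx (fun i => map_mx f (Q i)).
Proof.
move=> regQ K' g x x0 qx c jac.
apply: (regQ K' (g \o f : {rmorphism k -> K'}) x x0) => [i|].
  by rewrite map_mx_comp qx.
rewrite -[RHS]jac; congr (_ *m _); apply: eq_bigr => i _; congr (_ *: _).
by rewrite map_mx_comp /polar_mx map_mxD map_trmx.
Qed.

Lemma polar_mx_alternating (k : fieldType) n (Q : 'M[k]_n) :
  2%N \in [pchar k] -> alternating (polar_mx Q).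
Proof.
move=> char2 x; rewrite mulmxDr mulmxDl -[X in _ + X]trmx_mx11.
by rewrite !trmx_mul !trmxK mulmxA addrr_pchar2.
Qed.

Lemma alternating_sum (k : fieldType) n (I : finType) (c : I -> k) (B : I -> 'M[k]_n) :
  (forall i, alternating (B i)) -> alternating (\sum_i c i *: B i).
Proof.
move=> altB x; rewrite mulmx_sumr mulmx_suml big1 // => i _.
by rewrite -scalemxAr -scalemxAl altB scaler0.
Qed.

Lemma ord2_cases (i : 'I_2) : exists j, forall l, l = i \/ l = j.
Proof.
exists (1 - i) => l; case: i => [[|[|i]] //= ltin]; case: l => [[|[|l]] //= ltln];
  by [left; apply: val_inj | right; apply: val_inj].
Qed.

Lemma polar_mx_sum (k : fieldType) n (c : 'I_2 -> k) (Q : 'I_2 -> 'M[k]_n) :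
  polar_mx (\sum_i c i *: Q i) = \sum_i c i *: polar_mx (Q i).
Proof.
rewrite /polar_mx linear_sum -big_split /=; apply: eq_bigr => i _.
by rewrite linearZ scalerDr.
Qed.

Lemma map_mx_sum (k K : fieldType) (f : {rmorphism k -> K}) p n
    (c : 'I_2 -> k) (Q : 'I_2 -> 'M[k]_(p, n)) :
  map_mx f (\sum_i c i *: Q i) = \sum_i f (c i) *: map_mx f (Q i).
Proof.
rewrite -[LHS]/((map_mx f) (\sum_i c i *: Q i)) raddf_sum /=.
by apply: eq_bigr => i _; rewrite map_mxZ.
Qed.

Lemma sqrt_cvP (k : fieldType) d (a : 'I_d -> k) :
  (forall j, exists b, b ^+ 2 = a j) -> exists s : 'cV_d, forall j, s j 0 ^+ 2 = a j.
Proof.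
case/fin_all_exists=> s sE; exists (\col_j s j) => j.
by rewrite mxE sE.
Qed.

(** The rows of N span a 3-space in the radical of b_c, on which q_c is the
square of the linear form with coefficients s.  On a plane in the kernel of this
linear form, the other generator of the pencil has a zero over an extension,
and there the differential of q_c vanishes. *)
Lemma no_rank3_radical (k : fieldType) n (Q : 'I_2 -> 'M[k]_n) (c : 'I_2 -> k)
    (N : 'M[k]_(3, n)) (s : 'cV[k]_3) :
  2%N \in [pchar k] -> regular_mx Q -> (exists i, c i != 0) ->
  row_free N -> N *m polar_mx (\sum_i c i *: Q i) = 0 ->
  (forall j, s j 0 ^+ 2 = (N *m (\sum_i c i *: Q i) *m N^T) j j) -> False.
Proof.
move=> char2 regQ [i ci] freeN radN sN.
set q := \sum_i c i *: Q i in radN sN; set G := N *m q *m N^T in sN.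
have skewG : G + G^T = 0.
  by rewrite /G !trmx_mul trmxK mulmxA -mulmxDl -mulmxDr radN mul0mx.
have [|T freeT kerT] := @row_free_sub _ _ _ 2 (kermx s).
  by rewrite mxrank_ker; have := rank_leq_col s; lia.
have [j ij] := ord2_cases i.
pose R := T *m N.
have freeR : row_free R by rewrite /row_free mxrankMfree.
have [K [f [y [y0 yj]]]] := isotropic_vector (R *m Q j *m R^T).
have char2K : 2%N \in [pchar K] by rewrite (fmorph_pchar f).
pose z := y *m map_mx f T; pose x := z *m map_mx f N.
have xE : x = y *m map_mx f R by rewrite /x /z map_mxM mulmxA.
have x0 : x != 0.
  by rewrite xE mulmx_free_eq0 // row_free_map.
have qx : x *m map_mx f q *m x^T = 0.
  have -> : x *m map_mx f q *m x^T = z *m map_mx f G *m z^T.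
    by rewrite /x /G !map_mxM -!map_trmx ?map_mxM !trmx_mul !mulmxA.
  rewrite (@additive_form_square _ _ _ (map_mx f s)) //.
  - suff -> : z *m map_mx f s = 0 by rewrite mul0mx.
    rewrite /z -mulmxA -map_mxM.
    by rewrite (sub_kermxP kerT) map_mx0 mulmx0.
  - by rewrite map_trmx -map_mxD skewG map_mx0.
  - by move=> l; rewrite mxE [RHS]mxE -rmorphXn sN.
have qjx : x *m map_mx f (Q j) *m x^T = 0.
  by rewrite -[RHS]yj xE !map_mxM -!map_trmx ?map_mxM !trmx_mul !mulmxA.
have jac : x *m (\sum_l f (c l) *: map_mx f (polar_mx (Q l))) = 0.
  by rewrite -map_mx_sum -polar_mx_sum /x -mulmxA -map_mxM radN map_mx0 mulmx0.
have [] := negP ci; apply/eqP/(fmorph_inj f); rewrite rmorph0.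
apply: (regQ K f x x0 _ (fun l => f (c l))) => // l.
(* As c i != 0, the zeros of q and Q j are zeros of Q i. *)
have [->|->//] := ij l; apply/eqP.
have [->|neq_ij] := eqVneq i j; first by rewrite qjx.
move: qx; rewrite /q map_mx_sum mulmx_sumr mulmx_suml (bigD1 i) //= big1 => [|l' neq].
  rewrite addr0 -scalemxAr -scalemxAl => /eqP.
  by rewrite scaler_eq0 fmorph_eq0 (negPf ci).
have [eqi|->] := ij l'; first by rewrite eqi eqxx in neq.
by rewrite -scalemxAr -scalemxAl qjx scaler0.
Qed.

(** In odd dimension the radical of b_c has odd dimension, so dimension 2 forces
dimension 3; it remains to adjoin the square roots that make q_c a square. *)
Lemma polar_radical_le1 (k : fieldType) n (Q : 'I_2 -> 'M[k]_n) (c : 'I_2 -> k) :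
  2%N \in [pchar k] -> odd n -> regular_mx Q -> (exists i, c i != 0) ->
  (\rank (kermx (\sum_i c i *: polar_mx (Q i))) <= 1)%N.
Proof.
move=> char2 oddn regQ [i ci]; rewrite leqNgt; apply/negP => rk2.
set B := \sum_i _ in rk2.
have evenB : ~~ odd (\rank B).
  by apply/rank_alternating_even/alternating_sum => j; apply: polar_mx_alternating.
have [|N freeN kerN] := @row_free_sub _ _ _ 3 (kermx B).
  by move: rk2; rewrite mxrank_ker; have := rank_leq_row B; lia.
pose G := N *m (\sum_i c i *: Q i) *m N^T.
have [K [f sqrtG]] := adjoin_sqrts [seq G j j | j : 'I_3].
have [|s sG] := @sqrt_cvP K 3 (fun j => f (G j j)).
  by move=> j; apply: sqrtG; apply: image_f.
apply: (@no_rank3_radical K n _ (fun i => f (c i)) (map_mx f N) s _ (@regular_mx_map k K f n Q regQ)).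
- by rewrite (fmorph_pchar f).
- by exists i; rewrite fmorph_eq0.
- by rewrite row_free_map.
- rewrite -map_mx_sum /polar_mx map_trmx -map_mxD -map_mxM -/(polar_mx _).
  by rewrite polar_mx_sum (sub_kermxP kerN) map_mx0.
- by move=> j; rewrite sG -map_mx_sum map_trmx -!map_mxM [RHS]mxE.
Qed.

(** * Uniqueness of the isotropic subspace *)

Lemma map_polar_mx (k K : fieldType) (f : {rmorphism k -> K}) n (Q : 'M[k]_n) :
  polar_mx (map_mx f Q) = map_mx f (polar_mx Q).
Proof. by rewrite /polar_mx map_trmx -map_mxD. Qed.

Lemma sum_orth (k : fieldType) n p q (I : finType) (c : I -> k) (B : I -> 'M[k]_n)
    (X : 'M_(p, n)) (Y : 'M_(q, n)) :
  (forall i, X *m B i *m Y^T = 0) -> X *m (\sum_i c i *: B i) *m Y^T = 0.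
Proof.
move=> orth; rewrite mulmx_sumr mulmx_suml big1 // => i _.
by rewrite -scalemxAr -scalemxAl orth scaler0.
Qed.

Lemma map_orth (k K : fieldType) (f : {rmorphism k -> K}) n p q (B : 'M[k]_n)
    (X : 'M_(p, n)) (Y : 'M_(q, n)) :
  X *m B *m Y^T = 0 -> map_mx f X *m map_mx f B *m (map_mx f Y)^T = 0.
Proof. by move=> orth; rewrite map_trmx -!map_mxM orth map_mx0. Qed.

(** The space (U n V) + <u> is orthogonal to U + V.  Its dimension exceeds the
codimension of U + V by at least 2, so it meets the radical in dimension at
least 2. *)
Lemma two_isotropic_radical (k : fieldType) m n (B U V : 'M[k]_n) (u : 'rV_n) :
  alternating B -> (n <= 2 * m + 1)%N ->
  \rank U = m.+1 -> \rank V = m.+1 ->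
  U *m B *m U^T = 0 -> V *m B *m V^T = 0 ->
  (u <= U)%MS -> ~~ (u <= V)%MS -> u *m B *m V^T = 0 ->
  (2 <= \rank (kermx B))%N.
Proof.
move=> altB len rU rV isoU isoV uU uV uBV.
have orth : (U :&: V + u)%MS *m B *m (U + V)%MS^T = 0.
  have UB W : W *m B *m U^T = 0 -> W *m B *m V^T = 0 -> W *m B *m (U + V)%MS^T = 0.
    move=> WU WV; apply: orth_sym => //.
    by apply/eqP; rewrite -mulmxA -sub_kermx addsmx_sub !sub_kermx !mulmxA (orth_sym altB WU) (orth_sym altB WV) eqxx.
  apply: UB.
    have sU : (U :&: V + u <= U)%MS by rewrite addsmx_sub capmxSl.
    exact: orth_sub sU (submx_refl U) isoU.
  apply/eqP; rewrite -mulmxA -sub_kermx addsmx_sub !sub_kermx !mulmxA uBV eqxx andbT.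
  by rewrite (orth_sub (capmxSr U V) (submx_refl V) isoV).
have : (\rank (U :&: V) < \rank (U :&: V + u)%MS)%N.
  apply: rank_ltmx; rewrite ltmxE addsmxSl /=; apply: contra uV => sub.
  exact: submx_trans (submx_trans (addsmxSr _ _) sub) (capmxSr _ _).
have := mulmx0_rank_max orth; rewrite mxrank_tr.
have := mxrank_sum_cap U V; rewrite rU rV.
have := mxrank_mul_ker (U :&: V + u)%MS B.
have := mxrankS (capmxSr (U :&: V + u)%MS (kermx B)).
lia.
Qed.

(** The vector u for [two_isotropic_radical] comes from a degenerate member of
the pencil induced on complements of U n V in U and in V, whose dimensions are
equal and positive if U is not contained in V. *)
Lemma isotropic_unique (k : fieldType) m n (Q : 'I_2 -> 'M[k]_n) (U V : 'M[k]_n) :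
  2%N \in [pchar k] -> n = (2 * m + 1)%N -> regular_mx Q ->
  \rank U = m.+1 -> \rank V = m.+1 ->
  (forall i, U *m polar_mx (Q i) *m U^T = 0) ->
  (forall i, V *m polar_mx (Q i) *m V^T = 0) ->
  (U <= V)%MS.
Proof.
move=> char2 nE regQ rU rV isoU isoV; apply/negPn/negP => UV.
have rUd := mxrank_cap_compl U V; have rVd := mxrank_cap_compl V U.
have d0 : (0 < \rank (U :\: V)%MS)%N.
  rewrite lt0n mxrank_eq0; apply: contra UV => /eqP d0.
  by rewrite -(addsmx_diff_cap_eq U V) d0 adds0mx capmxSr.
set d := \rank (U :\: V)%MS in d0 rUd.
have rVd' : \rank (V :\: U)%MS = d.
  by rewrite capmxC in rVd; move: rUd rVd; rewrite rU rV; lia.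
have [//|P freeP sP] := @row_free_sub _ _ _ d (U :\: V)%MS.
have [|P' freeP' sP'] := @row_free_sub _ _ _ d (V :\: U)%MS; first by rewrite rVd'.
have sVP' : (V <= U :&: V + P')%MS.
  have /eqmxP/andP[_ sub] : (P' :=: (V :\: U)%MS)%MS.
    apply/eqmxP; rewrite -(mxrank_leqif_eq sP').2 rVd'; exact: freeP'.
  rewrite -(addsmx_diff_cap_eq V U) addsmxC capmxC.
  exact: addsmxS.
have [K [f [c [y [ci y0 yM]]]]] :=
  degenerate_member (fun i => P *m polar_mx (Q i) *m P'^T) d0.
have char2K : 2%N \in [pchar K] by rewrite (fmorph_pchar f).
set B := \sum_i c i *: map_mx f (polar_mx (Q i)).
have rB : (\rank (kermx B) <= 1)%N.
  have := @polar_radical_le1 K n _ c char2K _ (@regular_mx_map k K f n Q regQ) ci.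
  rewrite (eq_bigr _ (fun i _ => congr1 ( *:%R (c i)) (map_polar_mx f (Q i)))).
  by apply; rewrite nE; lia.
have altB : alternating B.
  by apply: alternating_sum => i; rewrite -map_polar_mx; apply: polar_mx_alternating.
suff: (2 <= \rank (kermx B))%N by rewrite leqNgt ltnS rB.
have isoUB : map_mx f U *m B *m (map_mx f U)^T = 0.
  by apply: sum_orth => i; apply: map_orth.
have isoVB : map_mx f V *m B *m (map_mx f V)^T = 0.
  by apply: sum_orth => i; apply: map_orth.
set u := y *m map_mx f P.
have u0 : u != 0 by rewrite mulmx_free_eq0 // row_free_map.
have sPf : (u <= map_mx f (U :\: V)%MS)%MS.
  by rewrite (submx_trans (submxMl _ _)) // map_submx.
have uU : (u <= map_mx f U)%MS.
  by apply: submx_trans sPf _; rewrite map_submx diffmxSl.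
apply: (@two_isotropic_radical K m n B (map_mx f U) (map_mx f V) u) => //.
- by rewrite nE.
- by rewrite mxrank_map.
- by rewrite mxrank_map.
- apply: contra u0 => uV; rewrite -submx0 -(map_mx0 f) -(capmx_diff U V) map_capmx.
  by rewrite sub_capmx sPf.
have sVf : (map_mx f V <= map_mx f (U :&: V)%MS + map_mx f P')%MS.
  by rewrite -map_addsmx map_submx.
have uP' : u *m B *m (map_mx f P')^T = 0.
  rewrite -[RHS]yM /u /B -!mulmxA; congr (y *m _).
  rewrite mulmx_suml mulmx_sumr; apply: eq_bigr => i _.
  by rewrite -scalemxAl -scalemxAr map_trmx mulmxA !map_mxM.
apply: orth_sym => //; apply: (orth_sub sVf (submx_refl u)).
apply/eqP; rewrite -mulmxA -sub_kermx addsmx_sub !sub_kermx !mulmxA.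
rewrite (orth_sym altB uP') eqxx andbT; apply/eqP.
by apply: (orth_sub _ uU isoUB); rewrite map_submx capmxSl.
Qed.

(** * Dimension of the base locus of the isotropic subspace *)

(** Here N spans L and the columns of S are the linear forms l_0, l_1.  If they
are dependent, their common kernel contains an m-dimensional T; the pairing of
T with a complement of L, also of dimension m, degenerates for some c.  A
vector of T in its kernel is orthogonal to the complement, and to L because L is
isotropic, so that it is a singular point of the base scheme. *)
Lemma base_plane_rank (k : fieldType) m n (Q : 'I_2 -> 'M[k]_n)
    (N : 'M[k]_(m.+1, n)) (S : 'M[k]_(m.+1, 2)) :
  2%N \in [pchar k] -> (0 < m)%N -> n = (2 * m + 1)%N -> regular_mx Q ->
  row_free N -> (forall i, N *m polar_mx (Q i) *m N^T = 0) ->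
  (forall i j, S j i ^+ 2 = (N *m Q i *m N^T) j j) ->
  \rank S = 2%N.
Proof.
move=> char2 m0 nE regQ freeN isoN sqrtS.
apply/eqP; rewrite eqn_leq rank_leq_col leqNgt; apply/negP => rS.
have [|T freeT kerT] := @row_free_sub _ _ _ m (kermx S).
  by rewrite mxrank_ker; move: rS; lia.
have rC : \rank (N^C)%MS = m by rewrite mxrank_compl (eqP freeN) nE; lia.
have [|C freeC sC] := @row_free_sub _ _ _ m (N^C)%MS; first by rewrite rC.
have fullNC : row_full (N + C)%MS.
  have sCC : (N^C <= C)%MS by rewrite -(mxrank_leqif_sup sC).2 rC.
  rewrite -sub1mx (submx_trans _ (addsmxS (submx_refl N) sCC)) // sub1mx.
  exact: addsmx_compl_full.
have [K [f [c [y [[i ci] y0 yM]]]]] :=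
  degenerate_member (fun i => T *m N *m polar_mx (Q i) *m C^T) m0.
have char2K : 2%N \in [pchar K] by rewrite (fmorph_pchar f).
set z := y *m map_mx f T; set x := z *m map_mx f N.
have x0 : x != 0 by rewrite !mulmx_free_eq0 // row_free_map.
set B := \sum_i c i *: map_mx f (polar_mx (Q i)).
have xN : x *m B *m (map_mx f N)^T = 0.
  apply: sum_orth => l; apply: (orth_sub (submxMl z _) (submx_refl _)).
  exact: map_orth.
have xC : x *m B *m (map_mx f C)^T = 0.
  rewrite -[RHS]yM /x /z /B -!mulmxA; congr (y *m _).
  rewrite mulmx_suml !mulmx_sumr; apply: eq_bigr => l _.
  by rewrite -scalemxAl -!scalemxAr map_trmx !map_mxM !mulmxA.
have jac : x *m B = 0.
  have : (1%:M : 'M_n) *m (x *m B)^T = 0.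
    apply/eqP; rewrite -sub_kermx (submx_trans (B := (map_mx f N + map_mx f C)%MS)) //.
      by rewrite -map_addsmx sub1mx row_full_map.
    have tr_orth p (Y : 'M_(p, n)) : x *m B *m Y^T = 0 -> Y *m (x *m B)^T = 0.
      by move=> orth; apply: (can_inj trmxK); rewrite trmx_mul trmxK orth trmx0.
    by rewrite addsmx_sub !sub_kermx !tr_orth ?eqxx.
  by rewrite mul1mx => /(congr1 trmx); rewrite trmxK trmx0.
have [] := negP ci; apply/eqP; apply: (regQ K f x x0 _ c jac) => l.
have -> : x *m map_mx f (Q l) *m x^T = z *m map_mx f (N *m Q l *m N^T) *m z^T.
  by rewrite /x !map_mxM -map_trmx trmx_mul !mulmxA.
rewrite (@additive_form_square _ _ _ (map_mx f (col l S))) //.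
- suff -> : z *m map_mx f (col l S) = 0 by rewrite mul0mx.
  rewrite /z -mulmxA -map_mxM colE mulmxA (sub_kermxP kerT) mul0mx.
  by rewrite map_mx0 mulmx0.
- rewrite map_trmx -map_mxD !trmx_mul trmxK mulmxA -mulmxDl -mulmxDr.
  by rewrite -/(polar_mx _) isoN map_mx0.
- by move=> j; rewrite [X in X ^+ 2]mxE [RHS]mxE -rmorphXn -sqrtS mxE.
Qed.

(** * Coordinates of subspaces and of quadratic forms *)

Import passmx.

Lemma dim_vsof (k : fieldType) (E : vectType k) (e : (\dim {:E}).-tuple E)
    (M : 'M[k]_(\dim {:E})) :
  basis_of {:E} e -> \dim (vsof e M) = \rank M.
Proof.
move=> eb.
have [R freeR RM] : exists2 R : 'M_(\rank M, _), row_free R & (R :=: M)%MS.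
  by exists (row_base M); [apply: row_base_free | apply: eq_row_base].
pose X := [tuple vecof e (row i R) | i < \rank M].
have comb (a : 'I_(\rank M) -> k) : \sum_i a i *: X`_i = vecof e (\row_i a i *m R).
  rewrite mulmx_sum_row linear_sum; apply: eq_bigr => i _.
  by rewrite linearZ mxE -tnth_nth tnth_mktuple.
have memX v : (v \in vsof e M) = (rVof e v <= R)%MS by rewrite RM rVof_sub.
suff: basis_of (vsof e M) X by apply: size_basis.
apply/andP; split; last first.
  apply/freeP => a; rewrite comb => /eqP; rewrite vecof_eq0 // mulmx_free_eq0 //.
  by move/eqP/rowP => a0 i; have := a0 i; rewrite !mxE.
rewrite eqEsubv; apply/andP; split.
  apply/span_subvP => v /tnthP[i ->].
  by rewrite tnth_mktuple memX vecofK // row_sub.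
apply/subvP => v; rewrite memX => /submxP[D vD].
have -> : v = \sum_i D 0 i *: X`_i.
  rewrite comb -(rVofK eb v) vD; congr (vecof e (_ *m R)).
  by apply/rowP => i; rewrite mxE.
by apply: memv_suml => i _; apply/memvZ/memv_span/mem_nth; rewrite size_tuple.
Qed.

Lemma rank_msof (k : fieldType) (E : vectType k) (e : (\dim {:E}).-tuple E)
    (U : {vspace E}) :
  basis_of {:E} e -> \rank (msof e U) = \dim U.
Proof. by move=> eb; rewrite -(dim_vsof _ eb) msofK. Qed.

Section FormMatrix.
Variables (k : fieldType) (E : vectType k).
Implicit Type q : qform E.

Lemma polarC q x y : polar q x y = polar q y x.
Proof. by rewrite /polar (addrC x) addrAC. Qed.

Lemma qformD q x y : q (x + y) = q x + q y + polar q x y.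
Proof. by rewrite /polar; ring. Qed.

(** The upper triangular matrix of the coefficients of q.  The symmetric matrix
of a bilinear form would not determine q in characteristic 2. *)
Definition form_mx q : 'M[k]_(\dim {:E}) :=
  \matrix_(i, j) if (i < j)%N then polar q (vbasis {:E})`_i (vbasis {:E})`_j
                 else if i == j then q (vbasis {:E})`_i else 0.

Let e := vbasis {:E}.
Let eb : basis_of {:E} e := vbasisP _.

(** [polar q x] packed as a linear form, to make the lemmas on linear maps apply
to it. *)
Definition polar_fun q x : {scalar E} :=
  HB.pack (polar q x) (GRing.isLinear.Build k E k *%R (polar q x) (@qform_polar _ _ q x)).

Lemma polar_sum q x (I : finType) (a : I -> k) (v : I -> E) :
  polar q x (\sum_i a i *: v i) = \sum_i a i * polar q x (v i).
Proof.
rewrite -[LHS]/(polar_fun q x _) linear_sum.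
by apply: eq_bigr => i _; rewrite linearZ.
Qed.

Lemma polar_coord q x y :
  polar q x y = (rVof e x *m polar_mx (form_mx q) *m (rVof e y)^T) 0 0.
Proof.
have entry (i j : 'I_(\dim {:E})) : polar q e`_i e`_j = polar_mx (form_mx q) i j.
  rewrite /polar_mx !mxE -/e; case: (ltngtP i j) => [ij|ij|/val_inj eqij].
  - by rewrite -val_eqE gtn_eqF // addr0.
  - by rewrite -val_eqE gtn_eqF //= add0r polarC.
  (* On the diagonal, polar q x x = q (2 x) - 2 q x = 2 q x. *)
  rewrite eqij eqxx /polar; have -> : e`_j + e`_j = 2%:R *: e`_j.
    by rewrite scaler_nat mulr2n.
  by rewrite qformZ; ring.
rewrite -[in LHS](rVofK eb y) -[in LHS](rVofK eb x).
rewrite /vecof polar_sum mxE; apply: eq_bigr => j _.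
rewrite polarC polar_sum mulrC [X in _ = _ * X]mxE [X in _ = X * _]mxE; congr (_ * _).
by apply: eq_bigr => i _; rewrite polarC entry.
Qed.

(** The difference of the two sides has zero polar form by [polar_coord], so it
is additive, and it vanishes on the multiples of the basis vectors. *)
Lemma form_coord q x : q x = (rVof e x *m form_mx q *m (rVof e x)^T) 0 0.
Proof.
pose d x := q x - (rVof e x *m form_mx q *m (rVof e x)^T) 0 0.
have dD : {morph d : x y / x + y}.
  move=> {}x y; rewrite /d qformD polar_coord !linearD /= /polar_mx.
  have mxD (A B : 'M[k]_1) : (A + B) 0 0 = A 0 0 + B 0 0 by rewrite mxE.
  rewrite !(mulmxDl, mulmxDr) !mxD.
  have -> : rVof e x *m (form_mx q)^T *m (rVof e y)^T = rVof e y *m form_mx q *m (rVof e x)^T.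
    by rewrite -[LHS]trmx_mx11 !trmx_mul !trmxK mulmxA.
  ring.
have d0 : d 0 = 0 by rewrite /d linear0 !mul0mx mxE subr0 -(scale0r 0) qformZ expr0n mul0r.
suff: d x = 0 by move/eqP; rewrite subr_eq0 => /eqP.
rewrite -(rVofK eb x) /vecof (big_morph d dD d0) big1 // => i _.
rewrite /d qformZ linearZ /= rVofE // linearZ /= -!scalemxAl -scalemxAr.
rewrite trmx_delta -rowE -colE !mxE ltnn eqxx mulrA -expr2.
by rewrite subrr.
Qed.

End FormMatrix.

(** * Extension of scalars of a pencil *)

Section MatrixForm.
Variables (k : fieldType) (n : nat) (Q : 'M[k]_n).

Definition mx_form (x : 'rV[k]_n) : k := (x *m Q *m x^T) 0 0.

Lemma mx_formZ a x : mx_form (a *: x) = a ^+ 2 * mx_form x.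
Proof.
by rewrite /mx_form linearZ /= -!scalemxAl -scalemxAr !mxE mulrA expr2.
Qed.

Lemma polar_mx_form x y : polar mx_form x y = (x *m polar_mx Q *m y^T) 0 0.
Proof.
have mxD (A B : 'M[k]_1) : (A + B) 0 0 = A 0 0 + B 0 0 by rewrite mxE.
have -> : x *m polar_mx Q *m y^T = x *m Q *m y^T + y *m Q *m x^T.
  rewrite /polar_mx mulmxDr mulmxDl; congr (_ + _).
  by rewrite -[LHS]trmx_mx11 !trmx_mul !trmxK mulmxA.
rewrite /polar /mx_form linearD /= !(mulmxDl, mulmxDr) !mxD; ring.
Qed.

Lemma mx_form_polar x : scalar (polar mx_form x).
Proof.
move=> a y z; rewrite !polar_mx_form linearP /= mulmxDr -scalemxAr.
by rewrite mxE [X in X + _]mxE.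
Qed.

Definition mx_qform : qform 'rV[k]_n := QForm mx_formZ mx_form_polar.

End MatrixForm.

(** The diagonal entries are values of the form at the basis vectors, and the
entries above the diagonal are values of its polar form.  This holds over all
fields, even those over which a nonzero polynomial may vanish everywhere. *)
Lemma triangular_form_eq0 (k : fieldType) n (M : 'M[k]_n) :
  (forall i j : 'I_n, (j < i)%N -> M i j = 0) ->
  (forall x : 'rV_n, (x *m M *m x^T) 0 0 = 0) -> M = 0.
Proof.
move=> trigM M0.
have ent (A : 'M[k]_n) (i j : 'I_n) : ((delta_mx 0 i : 'rV[k]_n) *m A *m (delta_mx 0 j : 'rV[k]_n)^T) 0 0 = A i j.
  by rewrite trmx_delta -rowE -colE !mxE.
have polM (x y : 'rV[k]_n) : (x *m polar_mx M *m y^T) 0 0 = 0.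
  by rewrite -polar_mx_form /polar /mx_form !M0 !subr0.
apply/matrixP => i j; rewrite [RHS]mxE; case: (ltngtP i j) => [ij|/trigM //|/val_inj <-].
  by have := polM (delta_mx 0 i) (delta_mx 0 j); rewrite ent !mxE (trigM j i ij) addr0.
by rewrite -ent M0.
Qed.

Section Regular.
Variables (k : fieldType) (E : vectType k) (W : pencil E).
Let e := vbasis {:E}.
Let eb : basis_of {:E} e := vbasisP _.

Definition pencil_mx (i : 'I_2) : 'M[k]_(\dim {:E}) := form_mx (W i).

(** Linear independence of the two generators is the fullness of the rank of a
matrix with entries in k, and rank is invariant under extension of scalars. *)
Lemma pencil_mx_free (K : fieldType) (f : {rmorphism k -> K}) (c : 'I_2 -> K) :
  \sum_i c i *: map_mx f (pencil_mx i) = 0 -> forall i, c i = 0.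
Proof.
pose A := \matrix_(i < 2) mxvec (pencil_mx i).
have freeA : row_free A.
  rewrite -kermx_eq0; apply/rowV0P => a /sub_kermxP; rewrite mulmx_sum_row => aA.
  have a0 : \sum_i a 0 i *: pencil_mx i = 0.
    apply: (can_inj mxvecK); rewrite linear0 -[RHS]aA linear_sum.
    by apply: eq_bigr => i _; rewrite linearZ rowK.
  apply/rowP => i; rewrite mxE; move: i; apply: (pencil_free (p := W)) => x.
  transitivity ((rVof e x *m (\sum_i a 0 i *: pencil_mx i) *m (rVof e x)^T) 0 0).
    rewrite mulmx_sumr mulmx_suml summxE; apply: eq_bigr => i _.
    by rewrite -scalemxAr -scalemxAl mxE form_coord.
  by rewrite a0 mulmx0 mul0mx mxE.
move=> c0 i.
have : (\row_i c i) *m map_mx f A = 0.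
  apply: (can_inj vec_mxK); rewrite linear0 -[RHS]c0 mulmx_sum_row linear_sum.
  by apply: eq_bigr => l _; rewrite linearZ -map_row rowK mxE /= map_mxvec mxvecK.
move/eqP; rewrite mulmx_free_eq0 ?row_free_map // => /eqP/rowP/(_ i).
by rewrite !mxE.
Qed.

Section Extension.
Variables (K : fieldType) (f : {rmorphism k -> K}).

Lemma ext_free (c : 'I_2 -> K) :
  (forall x, \sum_i c i * mx_qform (map_mx f (pencil_mx i)) x = 0) ->
  forall i, c i = 0.
Proof.
move=> c0; apply: (@pencil_mx_free K f); apply: triangular_form_eq0.
  move=> i j ji; rewrite summxE big1 // => l _.
  by rewrite !mxE ltnNge ltnW //= -val_eqE gtn_eqF // rmorph0 mulr0.
move=> x; rewrite -[RHS](c0 x) mulmx_sumr mulmx_suml summxE.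
by apply: eq_bigr => l _; rewrite -scalemxAr -scalemxAl mxE.
Qed.

Definition ext_pencil : pencil 'rV[K]_(\dim {:E}) := Pencil ext_free.

Definition ext_map (x : E) : 'rV[K]_(\dim {:E}) := map_mx f (rVof e x).

Lemma ext_map_linear : linear_for (f \; *:%R) ext_map.
Proof. by move=> a x y; rewrite /ext_map linearP map_mxD map_mxZ. Qed.

HB.instance Definition _ := GRing.isLinear.Build k E _ (f \; *:%R) ext_map ext_map_linear.

Lemma ext_pencil_extension :
  pencil_extension (ext_map : {linear E -> _ | f \; *:%R}) W ext_pencil.
Proof.
split.
  have dimV : \dim {: 'rV[K]_(\dim {:E})} = \dim {:E}.
    by rewrite [LHS]dimvf /dim /= mul1n.
  rewrite /extension_of_scalars basisEdim size_map size_tuple dimV leqnn andbT.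
  apply/subvP => x _; rewrite (row_sum_delta x).
  apply: memv_suml => i _; apply/memvZ/memv_span/mapP; exists e`_i.
    by rewrite mem_nth // size_tuple.
  by rewrite /= /ext_map rVofE // map_delta_mx.
exists 1%:M => [|i x]; first exact: unitmx1.
rewrite (bigD1 i) //= big1 => [|j ji]; last by rewrite mxE eq_sym (negPf ji) mul0r.
rewrite mxE eqxx mul1r addr0 /mx_form /ext_map map_trmx -!map_mxM mxE.
by rewrite -form_coord.
Qed.

End Extension.

(** The points over K are tested on [ext_pencil], the extension of W along f in
the coordinates of a basis of E. *)
Lemma regular_pencil_mx : regular W -> regular_mx pencil_mx.
Proof.
move=> regW K f x x0 qx c jac.
apply: (regW _ _ _ _ _ (ext_pencil_extension f) x x0) => [i|v].
  by rewrite /= /mx_form qx mxE.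
transitivity ((x *m (\sum_i c i *: map_mx f (polar_mx (pencil_mx i))) *m v^T) 0 0).
  rewrite mulmx_sumr mulmx_suml summxE; apply: eq_bigr => i _.
  by rewrite -scalemxAr -scalemxAl mxE polar_mx_form map_polar_mx.
by rewrite jac mul0mx mxE.
Qed.

End Regular.

(** * The canonical plane *)

(** A characterization without reference to a basis of E or of the pencil, so that
it passes to changes of basis and to extensions of scalars. *)
Definition maximal_isotropic_space (k : fieldType) (E : vectType k) (W : pencil E)
    (m : nat) (L : {vspace E}) : Prop :=
  \dim L = m.+1 /\
  forall i x y, x \in L -> y \in L -> polar (W i) x y = 0.

(** The relation between a pencil and the plane from which the plane is chosen.
For a regular pencil on a space of odd dimension at least 5 over a perfect field
of characteristic 2, exactly one
subspace is in this relation with it. *)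
Definition canonical_plane (k : fieldType) (E : vectType k) (W : pencil E)
    (Pi : {vspace E}) : Prop :=
  exists m L, [/\ \dim {:E} = (2 * m + 1)%N, maximal_isotropic_space W m L
    & forall x, x \in Pi <-> x \in L /\ in_base W x].

Section CanonicalPlane.
Variables (k : fieldType) (E : vectType k) (W : pencil E) (m : nat).
Hypotheses (char2 : 2%N \in [pchar k]) (dimE : \dim {:E} = (2 * m + 1)%N).
Let e := vbasis {:E}.
Let eb : basis_of {:E} e := vbasisP _.

Lemma mem_msof (L : {vspace E}) x : (x \in L) = (rVof e x <= msof e L)%MS.
Proof. by rewrite -mem_vecof // rVofK. Qed.

Lemma isotropic_msof (L : {vspace E}) i :
  (forall x y, x \in L -> y \in L -> polar (W i) x y = 0) ->
  msof e L *m polar_mx (pencil_mx W i) *m (msof e L)^T = 0.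
Proof.
move=> isoL; set M := msof e L; apply/matrixP => a b; rewrite [RHS]mxE.
have memL c : vecof e (row c M) \in L by rewrite mem_vecof // row_sub.
rewrite -(isoL _ _ (memL a) (memL b)) polar_coord !vecofK //.
rewrite tr_row colE mulmxA -!row_mul -colE -/(pencil_mx W i).
by rewrite [RHS]mxE [RHS]mxE.
Qed.

Lemma maximal_isotropic_space_exists : exists L, maximal_isotropic_space W m L.
Proof.
have altP i : alternating (polar_mx (pencil_mx W i)) by apply: polar_mx_alternating.
have [M [rM M0 M1]] := common_isotropic dimE (altP 0) (altP 1).
exists (vsof e M); split; first by rewrite dim_vsof.
move=> i x y; rewrite -!rVof_sub // => xM yM; rewrite polar_coord.
rewrite (orth_sub xM yM) ?mxE //.
by case: i => [[|[|i]] // lti]; [rewrite -[RHS]M0 | rewrite -[RHS]M1];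
   congr (_ *m polar_mx (pencil_mx W _) *m _); apply: val_inj.
Qed.

Hypothesis regW : regular W.

Lemma maximal_isotropic_space_unique L L' :
  maximal_isotropic_space W m L -> maximal_isotropic_space W m L' -> L = L'.
Proof.
suff sub L1 L2 : maximal_isotropic_space W m L1 -> maximal_isotropic_space W m L2 ->
    (L1 <= L2)%VS.
  by move=> isoL isoL'; apply/eqP; rewrite eqEsubv !sub.
move=> [d1 iso1] [d2 iso2]; rewrite -(sub_msof eb).
apply: (isotropic_unique char2 dimE (regular_pencil_mx regW)).
- by rewrite rank_msof.
- by rewrite rank_msof.
- by move=> i; apply: isotropic_msof; apply: iso1.
- by move=> i; apply: isotropic_msof; apply: iso2.
Qed.

(** On L the form q_i is the square of the linear form given by the i-th column
of S, so its zeros in L are the kernel of that form, and the kernel of S, of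
rank 2, is the space of common zeros. *)
Lemma base_of_isotropic_space L : perfect_field k -> (0 < m)%N ->
  maximal_isotropic_space W m L ->
  exists Pi : {vspace E}, \dim Pi = (m - 1)%N /\
    forall x, x \in Pi <-> x \in L /\ in_base W x.
Proof.
move=> perfk m0 [dimL isoL]; set M := msof e L.
have rM : \rank M = m.+1 by rewrite rank_msof.
have [|N freeN sNM] := @row_free_sub _ _ _ m.+1 M; first by rewrite rM.
have sMN : (M <= N)%MS by rewrite -(mxrank_leqif_sup sNM).2 rM.
pose q i := N *m pencil_mx W i *m N^T.
have [s sE] : exists s : 'I_2 -> 'cV[k]_m.+1, forall i j, s i j 0 ^+ 2 = q i j j.
  apply: (@fin_all_exists _ _ (fun i (s : 'cV_m.+1) => forall j, s j 0 ^+ 2 = q i j j)).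
  by move=> i; apply: sqrt_cvP => j; apply: perfk.
pose S := \matrix_(j, i) s i j 0.
have isoN i : N *m polar_mx (pencil_mx W i) *m N^T = 0.
  exact: (orth_sub sNM sNM (isotropic_msof (isoL i))).
have rS : \rank S = 2%N.
  apply: (base_plane_rank char2 m0 dimE (regular_pencil_mx regW) freeN isoN).
  by move=> i j; rewrite mxE sE.
exists (vsof e <<kermx S *m N>>%MS); split.
  rewrite dim_vsof // mxrank_gen mxrankMfree // mxrank_ker rS; lia.
have formN i z x : rVof e x = z *m N -> W i x = (z *m S) 0 i ^+ 2.
  move=> xz; rewrite form_coord xz.
  have -> : z *m N *m form_mx (W i) *m (z *m N)^T = z *m q i *m z^T.
    by rewrite trmx_mul !mulmxA.
  rewrite (@additive_form_square _ _ (q i) (col i S)) //.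
  - by rewrite mxE big_ord1 -expr2 colE mulmxA -colE mxE.
  - by rewrite !trmx_mul trmxK mulmxA -mulmxDl -mulmxDr isoN.
  - by move=> j; rewrite -sE !mxE.
move=> x; rewrite -rVof_sub // genmxE mem_msof; split.
  case/submxP=> D; rewrite mulmxA => xD; split.
    by rewrite xD (submx_trans (submxMl _ _)).
  by move=> i; rewrite (formN _ _ _ xD) -mulmxA mulmx_ker mulmx0 mxE expr0n.
case=> /(submx_trans)/(_ sMN)/submxP[z xz] bx.
rewrite xz submxMfree // sub_kermx; apply/eqP/rowP => i; rewrite [RHS]mxE.
by move/eqP: (formN i z x xz); rewrite bx eq_sym expf_eq0 => /eqP.
Qed.

Hypotheses (perfk : perfect_field k) (m0 : (0 < m)%N).

Lemma canonical_plane_exists : exists Pi, canonical_plane W Pi.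
Proof.
have [L isoL] := maximal_isotropic_space_exists.
by have [Pi [_ memPi]] := base_of_isotropic_space perfk m0 isoL; exists Pi, m, L.
Qed.

Lemma canonical_plane_dim Pi : canonical_plane W Pi -> \dim Pi = (m - 1)%N.
Proof.
case=> m' [L [dimE' isoL memPi]].
have mm' : m' = m by move: dimE'; rewrite dimE; lia.
rewrite mm' in isoL.
have [Pi' [dimPi' memPi']] := base_of_isotropic_space perfk m0 isoL.
suff -> : Pi = Pi' by [].
by apply/vspaceP => x; apply/idP/idP; rewrite memPi' memPi.
Qed.

End CanonicalPlane.

(** * Functoriality *)

Lemma polar_span0 (k : fieldType) (E : vectType k) (q : qform E) (X : seq E) :
  (forall u v, u \in X -> v \in X -> polar q u v = 0) ->
  forall x y, x \in <<X>>%VS -> y \in <<X>>%VS -> polar q x y = 0.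
Proof.
move=> qX.
have half u y : u \in X -> y \in <<X>>%VS -> polar q u y = 0.
  move=> uX yX; rewrite (coord_span (X := in_tuple X) yX) polar_sum big1 // => i _.
  by rewrite qX ?mulr0 ?mem_nth.
move=> x y xX yX; rewrite polarC (coord_span (X := in_tuple X) xX) polar_sum big1 // => i _.
by rewrite polarC half ?mulr0 ?mem_nth.
Qed.

Section Functoriality.
Variables (k K : fieldType) (f : {rmorphism k -> K}).
Variables (E : vectType k) (V : vectType K) (phi : {linear E -> V | f \; *:%R}).

Definition ext_space (U : {vspace E}) : {vspace V} :=
  <<[seq phi u | u <- vbasis U]>>%VS.

Lemma mem_ext_space (U : {vspace E}) u : u \in U -> phi u \in ext_space U.
Proof.
move=> uU; rewrite (coord_vbasis uU) linear_sum; apply: memv_suml => i _.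
by rewrite linearZ; apply/memvZ/memv_span/map_f/mem_nth; rewrite size_tuple.
Qed.

Lemma ext_space_sub (U : {vspace E}) (Z : {vspace V}) :
  (forall u, u \in U -> phi u \in Z) -> (ext_space U <= Z)%VS.
Proof. by move=> UZ; apply/span_subvP => _ /mapP[u uU ->]; apply/UZ/vbasis_mem. Qed.

Hypothesis ext_phi : extension_of_scalars phi.

(** The images of U and of a complement span V, and neither has a dimension
greater than that of its source; as dim V = dim E, both are equalities. *)
Lemma dim_ext_space U : \dim (ext_space U) = \dim U.
Proof.
have dimV : \dim {:V} = \dim {:E}.
  by rewrite -(span_basis ext_phi) (eqnP (basis_free ext_phi)) size_map size_tuple.
apply/eqP; rewrite eqn_leq (leq_trans (dim_span _)) ?size_map ?size_tuple //=.
have full : (ext_space U + ext_space U^C = {:V})%VS.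
  apply/eqP; rewrite eqEsubv subvf -(span_basis ext_phi) /=.
  apply/span_subvP => _ /mapP[u _ ->].
  have /memv_addP[a aU [b bU ->]] : u \in (U + U^C)%VS by rewrite addv_complf memvf.
  by rewrite linearD memv_add // mem_ext_space.
have := (dimv_add_leqif (ext_space U) (ext_space U^C)).1; rewrite full dimV.
have : (\dim (ext_space U^C) <= \dim U^C)%N.
  by rewrite (leq_trans (dim_span _)) // size_map size_tuple.
by rewrite dimv_compl; have := dimvS (subvf U); lia.
Qed.

Variables (W : pencil E) (W' : pencil V) (A : 'M[K]_2).
Hypothesis phiW : forall i x, W' i (phi x) = \sum_j A i j * f (W j x).

Lemma polar_ext i x y :
  polar (W' i) (phi x) (phi y) = \sum_j A i j * f (polar (W j) x y).
Proof.
rewrite /polar -linearD !phiW -!sumrB; apply: eq_bigr => j _.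
by rewrite !rmorphB; ring.
Qed.

Lemma ext_isotropic m L :
  maximal_isotropic_space W m L -> maximal_isotropic_space W' m (ext_space L).
Proof.
move=> [dimL isoL]; split=> [|i]; first by rewrite dim_ext_space.
apply: polar_span0 => _ _ /mapP[u uL ->] /mapP[v vL ->].
rewrite polar_ext big1 // => j _.
by rewrite isoL ?vbasis_mem // rmorph0 mulr0.
Qed.

Lemma ext_in_base x : in_base W x -> in_base W' (phi x).
Proof. by move=> bx i; rewrite phiW big1 // => j _; rewrite bx rmorph0 mulr0. Qed.

End Functoriality.

Theorem theorem4p4 :
  exists Pi : subspace_choice,
    [/\ canonical Pi,
        forall (m : nat) (k : fieldType) (E : vectType k) (W : pencil E),
          2%N \in [pchar k] -> perfect_field k ->
          (2 <= m)%N -> \dim {:E} = (2 * m + 1)%N -> regular W ->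
          is_plane (m - 2) (Pi k E W) /\
          (forall x, x \in Pi k E W -> in_base W x)
      & forall (k : fieldType) (E : vectType k) (W : pencil E),
          2%N \in [pchar k] -> perfect_field k -> quartic_del_pezzo W ->
          exists p : E, [/\ p != 0, in_base W p & Pi k E W = <[p]>%VS]].
Proof.
(* The zero space is a default value, taken where no subspace qualifies. *)
pose Pi : subspace_choice := fun k E W =>
  epsilon (inhabits 0%VS) (@canonical_plane k E W).
have PiP (m : nat) (k : fieldType) (E : vectType k) (W : pencil E) :
    2%N \in [pchar k] -> perfect_field k -> (2 <= m)%N ->
    \dim {:E} = (2 * m + 1)%N -> regular W ->
    canonical_plane W (Pi k E W) /\ \dim (Pi k E W) = (m - 1)%N.
  move=> char2 perfk m2 dimE regW.
  have planeW : canonical_plane W (Pi k E W).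
    by apply: epsilon_spec; apply: (canonical_plane_exists char2 dimE regW perfk); lia.
  by split; last exact: (canonical_plane_dim char2 dimE regW perfk (ltnW m2) planeW).
have planeP (m : nat) (k : fieldType) (E : vectType k) (W : pencil E) :
    2%N \in [pchar k] -> perfect_field k -> (2 <= m)%N ->
    \dim {:E} = (2 * m + 1)%N -> regular W ->
    is_plane (m - 2) (Pi k E W) /\ (forall x, x \in Pi k E W -> in_base W x).
  move=> char2 perfk m2 dimE regW.
  have [[? [? [_ _ memPi]]] dimPi] := PiP m k E W char2 perfk m2 dimE regW.
  by split=> [|x /memPi[]//]; rewrite /is_plane dimPi; lia.
exists Pi; split=> //.
- move=> m k K f E V phi W W' [char2 perfk] [char2K perfK] [m2 dimE regW].
  move=> [_ dimV regW'] [ext_phi [A _ phiW]].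
  have [[m1 [L [dimE' isoL memPi]]] dimPi] := PiP m k E W char2 perfk m2 dimE regW.
  have [[m1' [L' [dimV' isoL' memPi']]] dimPi'] := PiP m K V W' char2K perfK m2 dimV regW'.
  have eqm : m1 = m by move: dimE'; rewrite dimE; lia.
  have eqm' : m1' = m by move: dimV'; rewrite dimV; lia.
  rewrite eqm in isoL; rewrite eqm' in isoL'.
  have isoLV := ext_isotropic ext_phi phiW isoL.
  (* The maximal isotropic space of W' is the extension of that of W. *)
  have eqL := maximal_isotropic_space_unique char2K dimV regW' isoLV isoL'.
  apply/esym/eqP; rewrite eqEdim -/(ext_space phi _).
  rewrite (dim_ext_space ext_phi) dimPi dimPi' leqnn andbT.
  apply: ext_space_sub => u /memPi[uL bu]; apply/memPi'; rewrite -eqL.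
  by split; [apply: mem_ext_space | apply: (ext_in_base phiW)].
- move=> k E W char2 perfk [dimE regW].
  have [] := planeP 2%N k E W char2 perfk isT dimE regW.
  set P := Pi k E W; rewrite /is_plane subnn => dimP baseP.
  have p0 : vpick P != 0 by rewrite vpick0 -dimv_eq0 dimP.
  exists (vpick P); split=> //; first exact/baseP/memv_pick.
  by apply/esym/eqP; rewrite eqEdim -memvE memv_pick dim_vline p0 dimP.
Qed.
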